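(* Let $a_1,a_2,a_3,b_1,b_2,b_3$ be real numbers with $$a_1\ge 0,\quad a_1+a_2\ge 0,\quad a_1+a_2+a_3>0,\qquad b_1\ge 0,\quad b_1+b_2\ge 0,\quad b_1+b_2+b_3>0,$$ and suppose moreover that $a_2\ge 0$ and $b_2\ge 0$. Let $\{T(n,k)\}_{n\ge k\ge 0}$ be a triangular array of positive real numbers which, with the convention $T(n,k)=0$ for $k<0$ or $k>n$, satisfies $$T(n,k)=(a_1n+a_2k+a_3)\,T(n-1,k)+(b_1n+b_2k+b_3)\,T(n-1,k-1)$$ for all integers $n\ge 1$ and $0\le k\le n$. Put $P_n(q)=\sum_{k=0}^n T(n,k)q^k$ for $n\ge 0$. Then the polynomial sequence $\{P_n(q)\}_{n\ge 0}$ is strongly $q$-log-convex, i.e. for all integers $n\ge m\ge 1$, $$P_{m-1}(q)P_{n+1}(q)-P_m(q)P_n(q)\ge_q 0.$$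
   Context: For real polynomials $f(q),g(q)$, write $f(q)\ge_q g(q)$ if $f(q)-g(q)$ has only nonnegative coefficients as a polynomial in $q$. A sequence of real polynomials $\{f_n(q)\}_{n\ge 0}$ is strongly $q$-log-convex if $f_{m-1}(q)f_{n+1}(q)\ge_q f_m(q)f_n(q)$ for all $n\ge m\ge 1$. *)

(* Defs.v *)
From HB Require Import structures.
From mathcomp Require Import all_boot all_order all_algebra.
From mathcomp Require Import reals.

Set Implicit Arguments.
Unset Strict Implicit.
Unset Printing Implicit Defensive.

Import Order.TTheory GRing.Theory Num.Theory.

Local Open Scope ring_scope.

Definition qge (R : realType) (f g : {poly R}) : Prop :=
  forall i : nat, 0 <= (f - g)`_i.

Definition strongly_q_log_convex (R : realType) (f : nat -> {poly R}) : Prop :=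
  forall m n : nat, (1 <= m)%N -> (m <= n)%N ->
    qge (f m.-1 * f n.+1) (f m * f n).

(* The column index of an array is an integer, so that T(n, k - 1) with k = 0
   is the out-of-range entry T(n, -1). *)
Definition positive_triangular_array (R : realType) (T : nat -> int -> R) : Prop :=
  (forall n k : nat, (k <= n)%N -> 0 < T n k%:Z) /\
  (forall (n : nat) (k : int), k < 0 \/ n%:Z < k -> T n k = 0).

Definition row_poly (R : realType) (T : nat -> int -> R) (n : nat) : {poly R} :=
  \sum_(0 <= k < n.+1) T n k%:Z *: 'X^k.

(* Main.v *)
Require Import Defs.
From HB Require Import structures.
From mathcomp Require Import all_boot all_order all_algebra.
From mathcomp Require Import reals.
From mathcomp Require Import ring lra.

(* With e = a_2 + b_2 q and u_n of degree one, P_(n+1) = u_n P_n + q e P_n'.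
   Since u_n - u_m has nonnegative coefficients for m <= n, it suffices that
   the Wronskian P_m P_n' - P_m' P_n has nonnegative coefficients.
   Running the recurrence from row m to row n gives
   P_n = sum_b T(m,b) q^b z_b, where z_b has nonnegative coefficients that
   increase with b because a_2, b_2 >= 0. Then q times twice the Wronskian is
   the sum over i, b of
   T(m,i) T(m,b) q^(i+b) [(b - i)(z_b - z_i) + q (z_b + z_i)'].
   No log-concavity of the rows is involved; it can fail under the
   hypotheses. *)

Set Implicit Arguments.
Unset Strict Implicit.
Unset Printing Implicit Defensive.

Import Order.TTheory GRing.Theory Num.Theory.

Local Open Scope ring_scope.

(* The qualifier [Num.nneg] does not unify with [semiringClosed], which the
   closure lemmas of [polyOver] expect. *)
Definition nneg_sr (R : numDomainType) : semiringClosed R :=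
  GRing.SemiringClosed.clone R (@Num.Def.nneg_num_pred R) _.

Lemma nneg_srE (R : numDomainType) (x : R) : (x \in nneg_sr R) = (0 <= x).
Proof. by []. Qed.

Lemma polyOver_nnegP (R : numDomainType) (p : {poly R}) :
  reflect (forall i, 0 <= p`_i) (p \is a polyOver (nneg_sr R)).
Proof. by apply: (iffP polyOverP) => h i; move: (h i); rewrite nneg_srE. Qed.

Definition step (R : comNzRingType) (e u p : {poly R}) : {poly R} :=
  u * p + 'X * e * p^`().

Fixpoint orbit (R : comNzRingType) (e : {poly R}) (u : nat -> {poly R})
    (p : {poly R}) (l : nat) : {poly R} :=
  if l is l'.+1 then step e (u l') (orbit e u p l') else p.

Lemma orbit_sum (R : comNzRingType) (e : {poly R}) (u : nat -> {poly R})
    (r : seq nat) (c : nat -> R) (F : nat -> {poly R}) (l : nat) :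
  orbit e u (\sum_(i <- r) c i *: F i) l =
  \sum_(i <- r) c i *: orbit e u (F i) l.
Proof.
elim: l => [//|l IHl] /=.
rewrite IHl /step (raddf_sum (@deriv R)) !mulr_sumr -big_split /=.
by apply: eq_bigr => i _; rewrite derivZ -!scalerAr -scalerDr.
Qed.

(** The operator q d/dq multiplies q^b by b, so by the Leibniz rule moving ['X^b] out of a [step]
    adds [e *+ b] to the multiplier. *)
Lemma orbit_Xn (R : comNzRingType) (e : {poly R}) (u : nat -> {poly R})
    (b l : nat) :
  orbit e u 'X^b l = 'X^b * orbit e (fun k => u k + e *+ b) 1 l.
Proof.
elim: l => [|l IHl] /=; first by rewrite mulr1.
rewrite IHl /step derivM derivXn; case: b {IHl} => [|b] /=.
  by rewrite !expr0 !mulr0n; ring.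
by rewrite exprS; ring.
Qed.

Lemma step_nneg (R : numDomainType) (e u p : {poly R}) :
  e \is a polyOver (nneg_sr R) -> u \is a polyOver (nneg_sr R) ->
  p \is a polyOver (nneg_sr R) -> step e u p \is a polyOver (nneg_sr R).
Proof.
move=> he hu hp; rewrite /step rpredD ?rpredM //.
  exact: polyOverX.
exact: polyOver_deriv.
Qed.

Lemma orbit_nneg (R : numDomainType) (e : {poly R}) (u : nat -> {poly R})
    (p : {poly R}) (l : nat) :
  e \is a polyOver (nneg_sr R) -> (forall k, u k \is a polyOver (nneg_sr R)) ->
  p \is a polyOver (nneg_sr R) -> orbit e u p l \is a polyOver (nneg_sr R).
Proof. by move=> he hu hp; elim: l => [//|l IHl] /=; apply: step_nneg. Qed.

(** The gap between the two orbits obeys the recurrence with multiplier [w], plus the source term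
    [(w l - u l) * y]; it starts at 0 and every ingredient has nonnegative coefficients. *)
Lemma orbit_monotone (R : numDomainType) (e : {poly R})
    (u w : nat -> {poly R}) (p : {poly R}) (l : nat) :
  e \is a polyOver (nneg_sr R) -> (forall k, u k \is a polyOver (nneg_sr R)) ->
  (forall k, w k - u k \is a polyOver (nneg_sr R)) ->
  p \is a polyOver (nneg_sr R) ->
  orbit e w p l - orbit e u p l \is a polyOver (nneg_sr R).
Proof.
move=> he hu huw hp; elim: l => [|l IHl] /=; first by rewrite subrr rpred0.
set y := orbit e u p l in IHl *; set z := orbit e w p l in IHl *.
have -> : step e (w l) z - step e (u l) y =
          step e (w l) (z - y) + (w l - u l) * y.
  by rewrite /step derivB; ring.
have hw : w l \is a polyOver (nneg_sr R) by rewrite -(subrK (u l) (w l)) rpredD.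
by rewrite rpredD ?step_nneg // rpredM // orbit_nneg.
Qed.

(** Derivatives appear multiplied by ['X] because q d/dq is diagonal on monomials, which avoids the
    exponents b - 1. *)
Lemma wronskian_sum_nneg (R : numDomainType) (r : seq nat) (x : nat -> R)
    (z : nat -> {poly R}) :
  (forall i, i \in r -> 0 <= x i) ->
  (forall i, z i \is a polyOver (nneg_sr R)) ->
  (forall i b, (i <= b)%N -> z b - z i \is a polyOver (nneg_sr R)) ->
  forall p s : {poly R},
  p = \sum_(i <- r) x i *: 'X^i ->
  s = \sum_(i <- r) x i *: ('X^i * z i) ->
  p * ('X * s^`()) - 'X * p^`() * s \is a polyOver (nneg_sr R).
Proof.
move=> hx hz hmono p s Ep Es.
have XdXn i : 'X * ('X^i)^`() = 'X^i *+ i :> {poly R}.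
  by rewrite derivXn; case: i => [|i]; rewrite ?mulr0n ?mulr0 // mulrnAr -exprS.
(* The term of index (i, b) before symmetrization. It may have negative coefficients when b < i, so
   only its sum with [H b i] is controlled. *)
pose H i b : {poly R} :=
  (x i * x b) *: ('X^i * 'X^b * (z b *+ b - z b *+ i + 'X * (z b)^`())).
have -> : p * ('X * s^`()) - 'X * p^`() * s = \sum_(i <- r) \sum_(b <- r) H i b.
  have -> : 'X * s^`() =
      \sum_(b <- r) x b *: ('X^b * (z b *+ b + 'X * (z b)^`())).
    rewrite Es (raddf_sum (@deriv R)) mulr_sumr; apply: eq_bigr => b _ /=.
    rewrite derivZ derivM -scalerAr mulrDr mulrA XdXn; congr (_ *: _).
    by ring.
  have -> : 'X * p^`() = \sum_(i <- r) x i *: ('X^i *+ i).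
    rewrite Ep (raddf_sum (@deriv R)) mulr_sumr; apply: eq_bigr => i _ /=.
    by rewrite derivZ -scalerAr XdXn.
  rewrite Ep Es !big_distrl -sumrB; apply: eq_bigr => i _ /=.
  rewrite !mulr_sumr -sumrB; apply: eq_bigr => b _ /=.
  rewrite -!scalerAl -!scalerAr !scalerA -scalerBr /H; congr (_ *: _).
  by ring.
set S := \sum_(i <- r) _.
have S2 : S *+ 2 = \sum_(i <- r) \sum_(b <- r) (H i b + H b i).
  rewrite mulr2n {2}/S exchange_big -big_split; apply: eq_bigr => i _.
  by rewrite -big_split.
suff /polyOver_nnegP hS : S *+ 2 \is a polyOver (nneg_sr R).
  by apply/polyOver_nnegP => i; move: (hS i); rewrite coefMn pmulrn_lge0.
(* The order of the indices makes the natural number [b - i] a true difference and lets [hmono]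
   apply. *)
have Hsym i b : (i <= b)%N -> i \in r -> b \in r ->
    H i b + H b i \is a polyOver (nneg_sr R).
  move=> leib ir br.
  have -> : H i b + H b i = (x i * x b) *: ('X^i * 'X^b *
      ((z b - z i) *+ (b - i) + 'X * ((z b)^`() + (z i)^`()))).
    rewrite /H (mulrC (x b)) -scalerDr mulrnBr //; congr (_ *: _).
    by ring.
  rewrite polyOverZ ?nneg_srE ?mulr_ge0 ?hx //.
  rewrite rpredM ?rpredM ?polyOverXn //.
  by rewrite rpredD ?rpredMn ?hmono // rpredM ?polyOverX // rpredD ?polyOver_deriv.
rewrite S2 big_seq; apply: rpred_sum => i ir; rewrite big_seq.
apply: rpred_sum => b br.
by case/orP: (leq_total i b) => le; [|rewrite addrC]; apply: Hsym.
Qed.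

Lemma row_poly_nneg (R : realType) (T : nat -> int -> R) (n : nat) :
  positive_triangular_array T -> row_poly T n \is a polyOver (nneg_sr R).
Proof.
case=> Tpos _; rewrite /row_poly big_mkord; apply: rpred_sum => k _.
by rewrite polyOverZ ?rpredX ?polyOverX // nneg_srE ltW // Tpos // -ltnS.
Qed.

Lemma coef_row_poly (R : realType) (T : nat -> int -> R) (n k : nat) :
  positive_triangular_array T -> (row_poly T n)`_k = T n k%:Z.
Proof.
case=> _ T0; rewrite /row_poly big_mkord.
rewrite -(poly_def n.+1 (fun i => T n i%:Z)) coef_poly ltnS.
by case: leqP => // ltnk; rewrite T0 //; right.
Qed.

Theorem theorem2p4 (R : realType) (a1 a2 a3 b1 b2 b3 : R)
    (ha1 : 0 <= a1) (ha12 : 0 <= a1 + a2) (ha123 : 0 < a1 + a2 + a3)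
    (hb1 : 0 <= b1) (hb12 : 0 <= b1 + b2) (hb123 : 0 < b1 + b2 + b3)
    (ha2 : 0 <= a2) (hb2 : 0 <= b2)
    (T : nat -> int -> R) (hT : positive_triangular_array T)
    (hrec : forall n k : nat, (1 <= n)%N -> (k <= n)%N ->
      T n k%:Z =
        (a1 * n%:R + a2 * k%:R + a3) * T n.-1 k%:Z +
        (b1 * n%:R + b2 * k%:R + b3) * T n.-1 (k%:Z - 1)) :
  strongly_q_log_convex (row_poly T).
Proof.
pose e : {poly R} := a2%:P + b2 *: 'X.
(* [u n] leads from row n to row n + 1, hence [n.+1]. The extra [b2] comes from b2 k = b2 (k - 1) +
   b2, whose first part goes into the derivative term. *)
pose u n : {poly R} :=
  (a1 * n.+1%:R + a3)%:P + (b1 * n.+1%:R + b2 + b3) *: 'X.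
have he : e \is a polyOver (nneg_sr R).
  by rewrite rpredD ?polyOverC ?polyOverZ ?polyOverX.
(* The sign comes from positivity of the array: T(1,0) = (a1 + a3) T(0,0). *)
have ha13 : 0 <= a1 + a3.
  have := hrec 1%N 0%N isT isT; rewrite (hT.2 0%N (0%:Z - 1)); last by left.
  have T10 := hT.1 1%N 0%N isT; have T00 := hT.1 0%N 0%N isT.
  rewrite !mulr1 !mulr0 !addr0 => E; move: T10; rewrite E pmulr_lgt0 //.
  exact: ltW.
have hS n : 1 <= n.+1%:R :> R by rewrite ler1n.
have hu n : u n \is a polyOver (nneg_sr R).
  rewrite rpredD ?polyOverC ?polyOverZ ?polyOverX // nneg_srE.
    by have := ler_wpM2l ha1 (hS n); lra.
  by have := ler_wpM2l hb1 (hS n); lra.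
have hP n : row_poly T n.+1 = step e (u n) (row_poly T n).
  apply/polyP => k; rewrite /step.
  have -> : u n * row_poly T n + 'X * e * (row_poly T n)^`() =
      (a1 * n.+1%:R + a3) *: row_poly T n +
      (b1 * n.+1%:R + b2 + b3) *: (row_poly T n * 'X) +
      (a2 *: ((row_poly T n)^`() * 'X) +
       b2 *: ((row_poly T n)^`() * 'X * 'X)).
    by rewrite /u /e -!mul_polyC; ring.
  rewrite !coefD !coefZ !coefMX !coef_deriv !coef_row_poly //.
  (* Past degree n + 1 [hrec] says nothing, and both sides vanish by the support of [T]. Below, k =
     0 and k = 1 are separate because of the two nested shifts by ['X]. *)
  have [lekn|ltnk] := leqP k n.+1; last first.
    have T0 j : (n < j)%N -> T n j%:Z = 0 by move=> ltnj; apply: hT.2; right.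
    case: k ltnk => [|[|k]] // ltnk /=.
    rewrite (hT.2 n.+1); last by right.
    by rewrite !T0 ?(ltnW ltnk) // !mul0rn !mulr0 !addr0.
  rewrite hrec // succnK; case: k lekn => [|[|k]] lekn /=.
  - by rewrite (hT.2 n (0%:Z - 1)); [ring | left].
  - by rewrite subrr; ring.
  have -> : k.+2%:Z - 1 = k.+1%:Z by rewrite -addn1 PoszD addrK.
  by ring.
have horb m l :
    row_poly T (m + l) = orbit e (fun k => u (m + k)%N) (row_poly T m) l.
  by elim: l => [|l IHl] /=; rewrite ?addn0 // addnS hP IHl.
(* From here [m] is the predecessor of the original index, so m < n. *)
move=> [//|m] n _ ltmn; apply/polyOver_nnegP; rewrite succnK.
have lemn := ltnW ltmn.
have -> : row_poly T m * row_poly T n.+1 - row_poly T m.+1 * row_poly T n =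
  (u n - u m) * (row_poly T m * row_poly T n) +
  e * (row_poly T m * ('X * (row_poly T n)^`()) -
       'X * (row_poly T m)^`() * row_poly T n).
  by rewrite !hP /step; ring.
have hum : u n - u m \is a polyOver (nneg_sr R).
  have -> : u n - u m = (a1 * (n%:R - m%:R))%:P + (b1 * (n%:R - m%:R)) *: 'X.
    rewrite /u opprD addrACA -rmorphB -scalerBl /=.
    by congr (_%:P + _ *: 'X); ring.
  have : 0 <= n%:R - m%:R :> R by rewrite subr_ge0 ler_nat.
  by move=> h; rewrite rpredD ?polyOverC ?polyOverZ ?polyOverX // nneg_srE mulr_ge0.
rewrite rpredD // rpredM ?row_poly_nneg //; first by rewrite rpredM ?row_poly_nneg.
(* What the monomial q^b of row m becomes after n - m steps, with q^b divided out. *)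
pose z b := orbit e (fun k => u (m + k)%N + e *+ b) 1 (n - m).
have En : row_poly T n = \sum_(0 <= k < m.+1) T m k%:Z *: ('X^k * z k).
  rewrite -{1}(subnKC lemn) horb /row_poly orbit_sum.
  by apply: eq_bigr => k _; rewrite orbit_Xn.
apply: (wronskian_sum_nneg _ _ _ (erefl (row_poly T m)) En) => [k|b|i b leib].
- by rewrite mem_index_iota ltnS /= => lekm; apply/ltW/hT.1.
- by rewrite orbit_nneg ?rpred1 // => k; rewrite rpredD ?rpredMn.
apply: orbit_monotone => // [k|k|]; last exact: rpred1.
  by rewrite rpredD ?rpredMn.
(* The multipliers for b and i differ by [e *+ (b - i)]; this is where nonnegativity of [a2] and
   [b2] makes [z] increase. *)
by rewrite opprD addrACA subrr add0r -mulrnBr // rpredMn.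
Qed.
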